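(* Let $Q_\infty=(q_0,q_1,\dots,q_i,\dots)$ be a stochastic vector (all $q_i>0$, $\sum_{i=0}^\infty q_i=1$) such that for every $\alpha>0$ there exists a constant $c=c(\alpha)$ with $$\sum_{k=i+1}^\infty q_k^\alpha\le c(\alpha)\,q_i^\alpha\quad\text{for all } i\in\mathbb{N}_0 .$$ Then the family $\Phi=\Phi(Q_\infty)$ of all cylinders of the $Q_\infty$-expansion is faithful for the Hausdorff dimension calculation on the unit interval, i.e. $\dim_H(E,\Phi)=\dim_H(E)$ for every $E\subseteq[0,1)$.
   Context: $\mathbb{N}_0=\{0,1,2,\dots\}$, $\mathbb{N}=\{1,2,\dots\}$. Let $Q_\infty=(q_0,q_1,\dots)$ be a stochastic vector with all $q_i>0$ and $\sum_{i=0}^\infty q_i=1$. Cylinders. Decompose $[0,1)$ from left to right into consecutive disjoint half-open intervals $\Delta_{\alpha_1}$, $\alpha_1\in\mathbb{N}_0$, of length $q_{\alpha_1}$; that is, $\Delta_i=[\sum_{j<i}q_j,\ \sum_{j\le i}q_j)$. Inductively, for $n\ge 2$, decompose each $\Delta_{\alpha_1\dots\alpha_{n-1}}$ from left to right into consecutive disjoint half-open intervals $\Delta_{\alpha_1\dots\alpha_n}$, $\alpha_n\in\mathbb{N}_0$, (closed on the left, open on the right) of length $q_{\alpha_1}q_{\alpha_2}\cdots q_{\alpha_n}$. The intervals $\Delta_{\alpha_1\dots\alpha_n}$ are the cylinders of rank $n$ of the $Q_\infty$-expansion, and $\Phi(Q_\infty)=\{\Delta_{\alpha_1\dots\alpha_n}: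 n\in\mathbb{N},\ \alpha_1,\dots,\alpha_n\in\mathbb{N}_0\}$. Hausdorff dimension with respect to a family. For a family $\Phi$ of subsets and a set $E$, put $$H^\alpha(E,\Phi)=\lim_{\epsilon\to0}\ \inf\sum_j|E_j|^\alpha,$$ where the infimum is over all at most countable coverings $\{E_j\}$ of $E$ with $E_j\in\Phi$ and diameters $|E_j|\le\epsilon$; and $\dim_H(E,\Phi)=\inf\{\alpha: H^\alpha(E,\Phi)=0\}$. $\dim_H(E)$ denotes the classical Hausdorff dimension. *)

(* Defs.v *)
From HB Require Import structures.
From mathcomp Require Import all_boot all_order all_algebra.
From mathcomp Require Import all_classical all_reals all_analysis.

Set Implicit Arguments.
Unset Strict Implicit.
Unset Printing Implicit Defensive.

Import Order.TTheory GRing.Theory Num.Theory.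
Import numFieldNormedType.Exports.

Local Open Scope classical_set_scope.
Local Open Scope ring_scope.

(* The supremum is taken over a set containing 0, so that the diameter of the
   empty set is 0 and not -oo. *)
Definition diam (R : realType) (A : set R) : \bar R :=
  ereal_sup [set d | d = 0%E \/
    exists x y : R, [/\ A x, A y & d = (`|x - y|)%:E]].

(* The index set D is an arbitrary set of naturals, so that finite and empty
   coverings are allowed even when Phi does not contain the empty set. *)
Definition is_cover (R : realType) (Phi : set (set R)) (E : set R) (eps : R)
    (D : set nat) (U : nat -> set R) : Prop :=
  [/\ forall j, D j -> Phi (U j),
      forall j, D j -> (diam (U j) <= eps%:E)%E
    & E `<=` \bigcup_(j in D) U j].

Definition hausdorff_pre (R : realType) (Phi : set (set R)) (E : set R)
    (a eps : R) : \bar R :=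
  ereal_inf [set s | exists (D : set nat) (U : nat -> set R),
    is_cover Phi E eps D U /\ s = (\esum_(j in D) poweR (diam (U j)) a)%E].

Definition hausdorff (R : realType) (Phi : set (set R)) (E : set R) (a : R)
    : \bar R :=
  lim (hausdorff_pre Phi E a eps @[eps --> 0^'+]).

(* Exponents are restricted to a >= 0: since 0 `^ a = 0 for a < 0 in the
   library, negative exponents would be meaningless here.  At a = 0 the
   library's 0 `^ 0 = 1 gives the counting convention. *)
Definition hausdorff_dim (R : realType) (Phi : set (set R)) (E : set R)
    : \bar R :=
  ereal_inf [set a%:E | a in [set a : R | 0 <= a /\ hausdorff Phi E a = 0%E]].

(* Classical Hausdorff dimension: coverings by arbitrary subsets of R. *)
Definition classical_hausdorff_dim (R : realType) (E : set R) : \bar R :=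
  hausdorff_dim [set: set R] E.

Definition faithful (R : realType) (Phi : set (set R)) (X : set R) : Prop :=
  forall E : set R, E `<=` X ->
    hausdorff_dim Phi E = classical_hausdorff_dim E.

Definition stochastic (R : realType) (q : nat -> R) : Prop :=
  (forall i, 0 < q i) /\ (\sum_(0 <= i <oo) (q i)%:E = 1)%E.

(* An interval [x, x + l[ is encoded by the pair (x, l); its a-th piece lies to
   the right of the pieces numbered 0, ..., a - 1. *)
Definition subinterval (R : realType) (q : nat -> R) (I : R * R) (a : nat)
    : R * R :=
  (I.1 + I.2 * \sum_(j < a) q j, I.2 * q a).

Definition cylinder (R : realType) (q : nat -> R) (s : seq nat) : set R :=
  let I := foldl (subinterval q) (0, 1) s in `[I.1, I.1 + I.2[%classic.

(* Ranks are positive: [0, 1[ itself is not a cylinder. *)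
Definition cylinders (R : realType) (q : nat -> R) : set (set R) :=
  [set cylinder q s | s in [set s : seq nat | (0 < size s)%N]].

(* Main.v *)
(* Fix [a < b]. A set of diameter at most [d > 0] is covered by cylinders whose
   [b]-powers sum to [O(d^a)], as follows. Descend from [0, 1) along the
   leftmost child met by the set, until the length drops below [d]. What is left
   out at level [u] starts at the left end of a child of [u] and is shorter than
   [d]; by the tail condition it is covered at cost [O(d^a |u|^(b - a))], using
   either all the siblings from that child on or, if that child is longer than
   [d], a family of the same kind further down its leftmost branch. As lengths
   decay geometrically with the rank, these costs form a convergent geometric
   series. The diameters of the covering sets need no separate control, since
   each [|U_j|^b] is at most the total cost. *)
Require Import Defs.
From HB Require Import structures.
From mathcomp Require Import all_boot all_order all_algebra.
From mathcomp Require Import all_classical all_reals all_analysis.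
From mathcomp Require Import ring lra.

Import Order.TTheory GRing.Theory Num.Theory.
Import numFieldNormedType.Exports.

Local Open Scope classical_set_scope.
Local Open Scope ring_scope.

(** * Subadditivity of sums over index sets *)

Lemma subset_esum (R : realType) (T : choiceType) (A B : set T)
    (f : T -> \bar R) : A `<=` B ->
  (\esum_(i in A) f i <= \esum_(i in B) f i)%E.
Proof.
move=> AB; apply: ge_ereal_sup => _ [X [finX XA] <-].
by apply: esum_ge; exists X => //; split=> //; apply: subset_trans AB.
Qed.

Lemma esum_setU_le (R : realType) (T : choiceType) (A B : set T)
    (f : T -> \bar R) : (forall i, 0 <= f i)%E ->
  (\esum_(i in A `|` B) f i <= \esum_(i in A) f i + \esum_(i in B) f i)%E.
Proof.
move=> f0; rewrite (esumID A)//.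
by apply: leeD; apply: subset_esum => x; [case|case=> -[]].

Qed.

(** Removing from each [F n] what earlier sets contain makes the union disjoint and enlarges no
    set. *)
Lemma esum_bigcup_le (R : realType) (T : choiceType) (F : (set T)^nat)
    (f : T -> \bar R) : (forall i, 0 <= f i)%E ->
  (\esum_(i in \bigcup_n F n) f i <= \sum_(0 <= n <oo) \esum_(i in F n) f i)%E.
Proof.
move=> f0; rewrite seqDU_bigcup_eq nneseries_sum_bigcup//.
apply: lee_nneseries => [n _ _|n _]; first exact: esum_ge0.
by apply: subset_esum; apply: subset_seqDU.
Qed.

(** * Cylinders: endpoints, lengths, children, families of bounded cost *)

Section cylinder_covers.
Context {R : realType} (q : nat -> R).
Hypothesis q_stoch : stochastic q.

Definition left_end (s : seq nat) : R := (foldl (subinterval q) (0, 1) s).1.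
Definition len (s : seq nat) : R := (foldl (subinterval q) (0, 1) s).2.

Lemma cylinderE s x :
  cylinder q s x <-> left_end s <= x < left_end s + len s.
Proof. by rewrite /cylinder /= in_itv. Qed.

Lemma left_end_rcons s k :
  left_end (rcons s k) = left_end s + len s * \sum_(j < k) q j.
Proof. by rewrite /left_end foldl_rcons. Qed.

Lemma left_end_rcons0 s : left_end (rcons s 0) = left_end s.
Proof. by rewrite left_end_rcons big_ord0 mulr0 addr0. Qed.

Lemma len_rcons s k : len (rcons s k) = len s * q k.
Proof. by rewrite /len foldl_rcons. Qed.

Lemma right_end_rcons s k :
  left_end (rcons s k) + len (rcons s k) = left_end (rcons s k.+1).
Proof. by rewrite !left_end_rcons len_rcons big_ord_recr /= mulrDr addrA. Qed.

Lemma q_gt0 i : 0 < q i. Proof. by case: q_stoch. Qed.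

Lemma q_ge0 i : 0 <= q i. Proof. exact/ltW/q_gt0. Qed.

Lemma len_gt0 s : 0 < len s.
Proof.
elim/last_ind: s => [|s k IH]; first exact: ltr01.
by rewrite len_rcons mulr_gt0// q_gt0.
Qed.

Lemma len_ge0 s : 0 <= len s. Proof. exact/ltW/len_gt0. Qed.

Lemma sum_q_le1 n : \sum_(j < n) q j <= 1.
Proof.
rewrite -lee_fin -(proj2 q_stoch) -sumEFin.
rewrite -(big_mkord xpredT (fun i => (q i)%:E)).
by apply: nneseries_lim_ge => i _ _; rewrite lee_fin q_ge0.
Qed.

Lemma sum_q_gt c : c < 1 -> exists n, c < \sum_(j < n) q j.
Proof.
move=> c1; apply: contrapT => /forallNP H.
have : (\sum_(0 <= i <oo) (q i)%:E <= c%:E)%E.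
  apply: lime_le.
    by apply: is_cvg_nneseries => i _ _; rewrite lee_fin q_ge0.
  apply: nearW => n; rewrite sumEFin lee_fin big_mkord leNgt.
  exact/negP/H.
by rewrite (proj2 q_stoch) lee_fin leNgt c1.
Qed.

Lemma left_end_rcons_le u m n :
  (m <= n)%N -> left_end (rcons u m) <= left_end (rcons u n).
Proof.
move=> mn; rewrite !left_end_rcons lerD2l ler_pM2l ?len_gt0//.
by rewrite -(subnKC mn) big_split_ord /= lerDl sumr_ge0// => j _; rewrite q_ge0.
Qed.

(** Each [q i] shares the total mass 1 with [q 0] or [q 1], so it is at most 1 minus the smaller of
    these two. *)
Lemma contraction_ratio : exists2 r, 0 < r < 1 & forall i, q i <= r.
Proof.
have q01 := sum_q_le1 2; rewrite !big_ord_recl big_ord0 /= addr0 in q01.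
have q0 := q_gt0 0; have q1 := q_gt0 1.
set m := Num.min (q 0) (q 1).
have [m0 m1 m2] : [/\ 0 < m, m <= q 0 & m <= q 1].
  by rewrite lt_min q0 q1 !ge_min !lexx ?orbT.
have b1 : bump 0 0 = 1%N by [].
rewrite b1 in q01.
exists (1 - m); first lra.
move=> [|i]; first lra.
have := sum_q_le1 i.+2; rewrite big_ord_recr big_ord_recl /=.
have : 0 <= \sum_(j < i) q (bump 0 j) by apply: sumr_ge0 => j _; rewrite q_ge0.
lra.
Qed.

(** The right ends of the children of [u] tend to that of [u], so some exceed [x]; the first such
    child contains [x]. *)
Lemma cylinder_child u m x : cylinder q u x -> left_end (rcons u m) <= x ->
  exists2 k, (m <= k)%N & cylinder q (rcons u k) x.
Proof.
move=> /cylinderE /andP[ux xu] mx.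
have l0 := len_gt0 u.
have [|n xn] := @sum_q_gt ((x - left_end u) / len u).
  by rewrite ltr_pdivrMr// mul1r ltrBlDl.
have Hn : exists n, x < left_end (rcons u n).
  by exists n; rewrite left_end_rcons -ltrBlDl mulrC -ltr_pdivrMr.
case: (ex_minnP Hn) => p xp pmin.
case: p xp pmin => [|p] xp pmin.
  by move: xp; rewrite left_end_rcons0 ltNge ux.
exists p; last first.
  apply/cylinderE; rewrite right_end_rcons xp andbT leNgt.
  by apply/negP => /pmin; rewrite ltnn.
rewrite leqNgt; apply/negP => pm.
suff : x < x by rewrite ltxx.
apply: lt_le_trans xp (le_trans _ mx).
exact: left_end_rcons_le.
Qed.

(** Families are sets of words, so unions of families need no enumeration. The cost uses lengths,
    which multiply along words, in place of diameters. *)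
Definition coverable (a : R) (A : set R) (c : R) := exists W : set (seq nat),
  [/\ W `<=` [set s | 0 < size s]%N, A `<=` \bigcup_(s in W) cylinder q s &
      (\esum_(s in W) (len s `^ a)%:E <= c%:E)%E].

Lemma coverableS a A B c d :
  A `<=` B -> c <= d -> coverable a B c -> coverable a A d.
Proof.
move=> AB cd [W [W0 BW Wc]]; exists W; split=> //.
  exact: subset_trans BW.
by apply: le_trans Wc _; rewrite lee_fin.
Qed.

Lemma coverable0 a c : 0 <= c -> coverable a set0 c.
Proof.
by move=> c0; exists set0; split=> //; rewrite esum_set0 lee_fin.
Qed.

Lemma coverableU a A B c d :
  coverable a A c -> coverable a B d -> coverable a (A `|` B) (c + d).
Proof.
move=> [V [V0 AV Vc]] [W [W0 BW Wd]]; exists (V `|` W); split.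
- by move=> s [/V0|/W0].
- by rewrite bigcup_setU; apply: setUSS.
- rewrite EFinD; apply: le_trans (leeD Vc Wd).
  by apply: esum_setU_le => s; rewrite lee_fin powR_ge0.
Qed.

Lemma coverable_bigcup a (A : (set R)^nat) (c : nat -> R) d :
  (forall n, coverable a (A n) (c n)) ->
  (\sum_(0 <= n <oo) (c n)%:E <= d%:E)%E ->
  coverable a (\bigcup_n A n) d.
Proof.
move=> /choice[W HW] cd; exists (\bigcup_n W n); split.
- by move=> s [n _ Wns]; have [/(_ _ Wns)] := HW n.
- move=> x [n _ Anx]; have [_ /(_ _ Anx)[s Ws sx] _] := HW n.
  by exists s => //; exists n.
- apply: le_trans cd; apply: le_trans (esum_bigcup_le _ _ _ _ _) _.
    by move=> s; rewrite lee_fin powR_ge0.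
  apply: lee_nneseries => [n _ _|n _].
    by apply: esum_ge0 => s _; rewrite lee_fin powR_ge0.
  by have [] := HW n.
Qed.

(** * Covering sets of small diameter by cylinders *)

Section exponent.
(** The smaller exponent is [b], the larger one [b + e]. The tail bounded by [K] includes the term
    of index [i] itself. *)
Variables (b e K r : R).
Hypotheses (b0 : 0 <= b) (e0 : 0 < e).
Hypotheses (r01 : 0 < r < 1) (qr : forall i, q i <= r).
Hypothesis K1 : 1 <= K.
Hypothesis tailK : forall i,
  (\sum_(i <= k <oo) (q k `^ (b + e))%:E <= (K * q i `^ (b + e))%:E)%E.

(** This [n] is the induction measure of both descents below: passing to a child costs a factor of
    at most [r]. *)
Let len_small d u : 0 < d -> exists n, len u * r ^+ n <= d.
Proof.
move=> d0; have [r0 r1] := andP r01.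
have /cvgrPdist_le /(_ _ d0) [n _ /(_ n (leqnn n))] :
    (fun n => len u * r ^+ n) @ \oo --> (0 : R).
  rewrite -(mulr0 (len u)); apply: cvgMl_tmp; apply: cvg_expr.
  by rewrite ger0_norm// ltW.
rewrite sub0r normrN => /(le_trans (ler_norm _)); by exists n.
Qed.

(** The exponent [b] is spent on the scale [d]; the remaining [e] is kept on an ambient length [y],
    whose decay will make the costs summable. *)
Let powRD_le x y d : 0 < x -> x <= d -> x <= y ->
  x `^ (b + e) <= d `^ b * y `^ e.
Proof.
move=> x0 xd xy; rewrite powRD ?(gt_eqF x0) ?implybT//.
by apply: ler_pM; rewrite ?powR_ge0// ge0_ler_powR// ?nnegrE ?ltW//;
  apply: lt_le_trans x0 _.
Qed.

Let len_rcons_le u k : len (rcons u k) <= r * len u.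
Proof. by rewrite len_rcons mulrC ler_wpM2r// len_ge0. Qed.

Let len_rcons_le1 u k : len (rcons u k) <= len u.
Proof.
have [r0 r1] := andP r01; apply: le_trans (len_rcons_le u k) _.
by rewrite ler_piMl ?len_ge0// ltW.
Qed.

(** All children of [u] from [m] on are used; the common factor [len u] comes out of the sum, which
    leaves a tail of the [q k]. *)
Lemma coverable_tail u m :
  coverable (b + e) [set x | cylinder q u x /\ left_end (rcons u m) <= x]
    (K * len (rcons u m) `^ (b + e)).
Proof.
exists (rcons u @` [set k | m <= k]%N); split.
- by move=> _ [k _ <-] /=; rewrite size_rcons.
- move=> x [ux mx]; have [k mk kx] := cylinder_child u m x ux mx.
  by exists (rcons u k) => //; exists k.
rewrite esum_image; last by move=> i j _ _ /rcons_inj[].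
pose f k := (len (rcons u k) `^ (b + e))%:E.
rewrite -(@nneseries_esum _ f (leq m)) -?(ereal_series f); last first.
  by move=> n _; rewrite lee_fin powR_ge0.
under eq_eseriesr do rewrite /f len_rcons powRM ?len_ge0 ?q_ge0// EFinM.
rewrite nneseriesZl; last by move=> i _; rewrite lee_fin powR_ge0.
rewrite len_rcons powRM ?len_ge0 ?q_ge0// mulrCA EFinM.
apply: lee_wpmul2l; first by rewrite lee_fin powR_ge0.
exact: tailK.
Qed.

Lemma coverable_left u m d : 0 < d ->
  coverable (b + e)
    [set x | cylinder q u x /\
      left_end (rcons u m) <= x < left_end (rcons u m) + d]
    (K * (d `^ b * len u `^ e)).
Proof.
move=> d0; have [n] := len_small d (rcons u m) d0.
have K0 : 0 < K by apply: lt_le_trans K1.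
have [r0 _] := andP r01.
elim: n u m => [|n IH] u m ud.
  apply: coverableS (coverable_tail u m); first by move=> x [ux /andP[? _]].
  by rewrite expr0 mulr1 in ud; rewrite ler_pM2l// powRD_le ?len_gt0.
have [lud|dlu] := lerP (len (rcons u m)) d.
  apply: coverableS (coverable_tail u m); first by move=> x [ux /andP[? _]].
  by rewrite ler_pM2l// powRD_le ?len_gt0.
(* The piece lies inside the long child and starts at the left end of its child 0. Nothing is added
   to the cost, so the constant [K] survives the recursion. *)
apply: coverableS (IH (rcons u m) 0%N _).
- move=> x [ux /andP[lx xr]].
  rewrite /= (left_end_rcons0 (rcons u m)) lx xr; split=> //.
  by apply/cylinderE; rewrite lx (lt_trans xr)// ltrD2l.
- rewrite ler_pM2l// ler_wpM2l ?powR_ge0// ge0_ler_powR ?nnegrE ?len_ge0//.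
  exact: ltW.
- apply: le_trans ud; rewrite exprS mulrA ler_wpM2r ?exprn_ge0 ?(ltW r0)//.
  by rewrite len_rcons ler_wpM2l// len_ge0.
Qed.

Lemma coverable_small : exists2 C : R, 0 < C &
  forall A d u, 0 < d -> (forall x y, A x -> A y -> `|x - y| <= d) ->
  coverable (b + e) (A `&` cylinder q u) (C * (d `^ b * len u `^ e)).
Proof.
have [r0 r1] := andP r01.
have K0 : 0 < K by apply: lt_le_trans K1.
have re1 : 0 < 1 - r `^ e.
  rewrite subr_gt0 -[ltRHS](powRr0 r) /powR gt_eqF// ltr_expR.
  by rewrite ltr_nM2r ?ln_lt0.
(* The sum of the geometric series with first term [K] and ratio r^e, hence the fixed point in
   [CK]. *)
set C := K / (1 - r `^ e).
have CK : C * r `^ e + K = C by rewrite /C; field; rewrite gt_eqF.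
have C0 : 0 < C by rewrite divr_gt0.
have KC : K <= C.
  by rewrite -{1}CK lerDr mulr_ge0 ?powR_ge0// ltW.
exists C => // A d u d0 Ad.
have [n] := len_small d u d0.
(* The descent stops here. All children of [v] are taken rather than [v], which also serves the
   empty word, whose interval is not a cylinder. *)
have small v : len v <= d ->
    coverable (b + e) (A `&` cylinder q v) (C * (d `^ b * len v `^ e)).
  move=> vd; apply: coverableS (coverable_tail v 0).
    move=> x [_ vx]; split=> //.
    by rewrite left_end_rcons0; case/cylinderE/andP: vx.
  rewrite ler_pM// ?powR_ge0 ?(ltW K0)// powRD_le ?len_gt0//.
  exact: le_trans (len_rcons_le1 v 0) vd.
elim: n u => [|n IH] u ud; first by apply: small; rewrite expr0 mulr1 in ud.
have [/small//|dlu] := lerP (len u) d.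
have [Au0|/set0P[x [Ax ux]]] := eqVneq (A `&` cylinder q u) set0.
  rewrite Au0; apply: coverable0.
  by rewrite mulr_ge0 ?(ltW C0)// mulr_ge0 ?powR_ge0.
have exi : exists i, `[< A `&` cylinder q (rcons u i) !=set0 >].
  have [|i _ ix] := cylinder_child u 0 x ux.
    by rewrite left_end_rcons0; case/cylinderE/andP: ux.
  by exists i; apply/asboolP; exists x.
case: (ex_minnP exi) => i /asboolP[z [Az iz]] imin.
apply: (@coverableS _ _ _ (C * (d `^ b * len (rcons u i) `^ e) + 
    K * (d `^ b * len u `^ e))); last 1 first.
- apply: coverableU (IH (rcons u i) _) (coverable_left u i.+1 d d0).
  apply: le_trans ud; rewrite exprS mulrA ler_wpM2r ?exprn_ge0 ?(ltW r0)//.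
  by rewrite mulrC.
(* By minimality of [i], points left of child [i.+1] lie in child [i]. The others are within [d] of
   [z], which lies left of child [i.+1], hence within [d] of its left end. *)
- move=> y [Ay uy]; have [yi|iy] := ltP y (left_end (rcons u i.+1)).
    have ly : left_end (rcons u 0) <= y.
      by rewrite left_end_rcons0; case/cylinderE/andP: uy.
    have [k _ ky] := cylinder_child u 0 y uy ly.
    have ik : (i <= k)%N by apply: imin; apply/asboolP; exists y.
    left; split=> //; apply/cylinderE; rewrite right_end_rcons yi andbT.
    by apply: le_trans (left_end_rcons_le u _ _ ik) _; case/cylinderE/andP: ky.
  right; split=> //; rewrite iy /=.
  have /cylinderE/andP[_] := iz; rewrite right_end_rcons => zi.
  have := Ad _ _ Ay Az; rewrite ler_norml => /andP[_]; lra.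
- rewrite -{2}CK mulrDl lerD2r -mulrA ler_pM2l// [leRHS]mulrCA.
  rewrite ler_wpM2l ?powR_ge0// -powRM ?len_ge0 ?(ltW r0)//.
  rewrite ge0_ler_powR ?nnegrE ?mulr_ge0 ?len_ge0//; exact: ltW.
Qed.
End exponent.
End cylinder_covers.

(** * Diameters and Hausdorff premeasures *)

Lemma diam_ge0 (R : realType) (A : set R) : (0 <= diam A)%E.
Proof. by apply: ereal_sup_ubound; left. Qed.

Lemma dist_le_diam (R : realType) (A : set R) x y :
  A x -> A y -> (`|x - y|%:E <= diam A)%E.
Proof. by move=> Ax Ay; apply: ereal_sup_ubound; right; exists x, y. Qed.

Lemma diam_cylinder_le (R : realType) (q : nat -> R) (s : seq nat) :
  stochastic q -> (diam (cylinder q s) <= (len q s)%:E)%E.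
Proof.
move=> q_stoch; apply: ge_ereal_sup => _ [->|[x [y [+ + ->]]]].
  by rewrite lee_fin len_ge0.
move=> /cylinderE/andP[x1 x2] /cylinderE/andP[y1 y2].
rewrite lee_fin ler_norml; lra.
Qed.

Lemma hausdorff_pre_ge0 (R : realType) (Phi : set (set R)) E a eps :
  (0 <= hausdorff_pre Phi E a eps)%E.
Proof.
apply: le_ereal_inf_tmp => _ [D [U [_ ->]]].
by apply: esum_ge0 => *; exact: poweR_ge0.
Qed.

Lemma hausdorff_pre_sub (R : realType) (Phi Psi : set (set R)) E a eps :
  Phi `<=` Psi -> (hausdorff_pre Psi E a eps <= hausdorff_pre Phi E a eps)%E.
Proof.
move=> sub; apply: ereal_inf_le_tmp => _ [D [U [[PhiU epsU EU] ->]]].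
by exists D, U; split=> //; split=> // j /PhiU/sub.
Qed.

Lemma hausdorff_pre_nonincreasing (R : realType) (Phi : set (set R)) E a :
  {homo hausdorff_pre Phi E a : x y / x <= y >-> (y <= x)%E}.
Proof.
move=> x y xy; apply: ereal_inf_le_tmp => _ [D [U [[PhiU epsU EU] ->]]].
exists D, U; split=> //; split=> // j /epsU /le_trans; apply.
by rewrite lee_fin.
Qed.

(** The premeasure grows as [eps] decreases, so its limit at 0 dominates every value. *)
Lemma hausdorff_eq0 (R : realType) (Phi : set (set R)) E a :
  hausdorff Phi E a = 0%E <->
  forall eps, 0 < eps -> hausdorff_pre Phi E a eps = 0%E.
Proof.
split=> [H0 eps eps0|H0].
  apply/eqP; rewrite eq_le hausdorff_pre_ge0 andbT -H0; apply: lime_ge.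
    apply: nonincreasing_at_right_is_cvge; apply: nearW => x y z _ _.
    exact: hausdorff_pre_nonincreasing.
  near=> x; apply: hausdorff_pre_nonincreasing.
  by near: x; exact: nbhs_right_le.
apply/cvg_lim => //; apply: cvg_near_cst.
by near=> x; apply: H0; near: x; exact: nbhs_right_gt.
Unshelve. all: by end_near. Qed.

(** * Null measures and coverings of arbitrarily small cost *)

Lemma hausdorff_pre_eq0 (R : realType) (q : nat -> R) E b eps :
  stochastic q -> 0 < b -> 0 < eps -> (forall t, 0 < t -> coverable q b E t) ->
  hausdorff_pre (cylinders q) E b eps = 0%E.
Proof.
move=> q_stoch b0 eps0 cov; apply/eqP; rewrite eq_le hausdorff_pre_ge0 andbT.
apply/lee_addgt0Pr => t t0; rewrite add0e.
(* The bound [t] controls the cost; the bound eps^b controls each single term, hence each length, as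
   [b] is positive. *)
have [|W [W0 EW Wt]] := cov (Num.min t (eps `^ b)).
  by rewrite lt_min t0 powR_gt0.
have [Wt1 Wt2] : (\esum_(s in W) (len q s `^ b)%:E <= t%:E /\
   \esum_(s in W) (len q s `^ b)%:E <= (eps `^ b)%:E)%E.
  by split; apply: le_trans Wt _; rewrite lee_fin ge_min lexx ?orbT.
pose U n := if unpickle n is Some s then cylinder q s else set0.
have UE (s : seq nat) : U (pickle s) = cylinder q s by rewrite /U pickleK.
have diam_le s : (diam (cylinder q s) <= (len q s)%:E)%E.
  exact: diam_cylinder_le.
apply: le_trans _ Wt1; apply: le_trans (ereal_inf_lbound _) _.
  exists (pickle @` W), U; split; last by [].
  split.
  - by move=> _ [s Ws <-]; rewrite UE; exists s => //; exact: W0.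
  - move=> _ [s Ws <-]; rewrite UE; apply: le_trans (diam_le s) _.
    rewrite lee_fin leNgt; apply/negP => epss.
    have : eps `^ b < len q s `^ b.
      by apply: gt0_ltr_powR => //; rewrite nnegrE ?len_ge0// ltW.
    apply/negP; rewrite -leNgt -lee_fin.
    apply: le_trans Wt2; apply: esum_ge.
    by exists [set s]; [split=> // _ ->|rewrite fsbig_set1].
  - by move=> x /EW[s Ws sx]; exists (pickle s); [exists s|rewrite UE].
rewrite esum_image; last by move=> s s' _ _; apply: (pcan_inj pickleK).
apply: le_esum => s _; rewrite UE -poweR_EFin.
apply: gt0_ler_poweR => //; first exact: ltW.
- by rewrite in_itv/= leey diam_ge0.
- by rewrite in_itv/= leey lee_fin len_ge0.
Qed.

(* A covering set may have diameter 0, while [coverable_small] needs [d > 0]. *)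
Lemma powR_perturb (R : realType) (x a t : R) : 0 <= x -> 0 <= a -> 0 < t ->
  exists d, [/\ 0 < d, x <= d & d `^ a <= x `^ a + t].
Proof.
rewrite le_eqVlt => /predU1P[<-|x0] a0 t0; last first.
  by exists x; rewrite lerDl (ltW t0).
move: a0; rewrite le_eqVlt => /predU1P[<-|a0].
  by exists 1; rewrite !powRr0 lerDl (ltW t0) ltr01 ler01.
exists (t `^ a^-1); rewrite -powRrM mulVf ?gt_eqF// powRr1 ?(ltW t0)//.
by rewrite powR_gt0// powR_ge0 lerDr powR_ge0.
Qed.

(** Each set of a cheap classical covering is replaced by cylinders at cost [C] times its [a]-power,
    up to a summable error. Coverings at the single scale 1 suffice, as this already makes all
    diameters finite. *)
Lemma coverable_hausdorff0 (R : realType) (q : nat -> R) E a e : stochastic q ->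
  (forall a : R, 0 < a -> exists c : R, forall i : nat,
      (\sum_(i.+1 <= k <oo) (powR (q k) a)%:E <= (c * powR (q i) a)%:E)%E) ->
  E `<=` `[0, 1[ -> 0 <= a -> 0 < e -> hausdorff [set: set R] E a = 0%E ->
  forall t, 0 < t -> coverable q (a + e) E t.
Proof.
move=> q_stoch q_tail E01 a0 e0 /hausdorff_eq0 /(_ 1 ltr01) H0 t t0.
have [r r01 qr] := contraction_ratio _ q_stoch.
have [c qc] := q_tail (a + e) (ltr_wpDl a0 e0).
(* The 1 pays for the term of index [i], absent from the tail in the hypothesis. *)
pose K := 1 + `|c|.
have K1 : 1 <= K by rewrite lerDl.
have tailK i : (\sum_(i <= k <oo) (q k `^ (a + e))%:E <=
    (K * q i `^ (a + e))%:E)%E.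
  rewrite (nneseries_split i 1); last by move=> k _; rewrite lee_fin powR_ge0.
  rewrite addn1 big_nat1 mulrDl mul1r EFinD; apply: leeD => //.
  by apply: le_trans (qc i) _; rewrite lee_fin ler_wpM2r ?powR_ge0// ler_norm.
have [C C0 small] := coverable_small q q_stoch a e K r a0 e0 r01 qr K1 tailK.
(* One half pays for the covering, the other for the errors [tau n]. *)
pose t' := t / C / 2.
have t'0 : 0 < t' by rewrite !divr_gt0.
have : (hausdorff_pre [set: set R] E a 1 < t'%:E)%E by rewrite H0 lte_fin.
move=> /ereal_inf_lt[_ [D [U [[_ U1 EU] ->]]] Ut].
(* Indices outside [D] must be set to 0 explicitly: for [a] = 0 even an empty set would contribute
   1. *)
pose f n := if n \in D then poweR (diam (U n)) a else 0%E.
have f0 n : (0 <= f n)%E by rewrite /f; case: ifP => // _; exact: poweR_ge0.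
have diam_fin n : D n -> diam (U n) \is a fin_num.
  move=> Dn; rewrite ge0_fin_numE ?diam_ge0//.
  exact: le_lt_trans (U1 n Dn) (ltry _).
have f_fin n : f n \is a fin_num.
  rewrite /f; case: ifP => // /set_mem Dn.
  by rewrite fin_num_poweR// diam_fin.
pose A n := if n \in D then U n `&` cylinder q [::] else set0.
apply: (@coverableS _ _ _ _ (\bigcup_n A n) t t) => //.
  move=> x Ex; have [n Dn Unx] := EU x Ex.
  exists n => //; rewrite /A mem_set//; split=> //.
  by have := E01 x Ex; rewrite /cylinder /= add0r.
pose tau n : R := t' / (2 ^ n.+1)%:R.
apply: (coverable_bigcup _ _ _ (fun n => C * (fine (f n) + tau n))).
  move=> n; rewrite /A; case: ifPn => [/[dup] nD /set_mem Dn|nD]; last first.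
    apply: coverable0; rewrite mulr_ge0 ?(ltW C0)//.
    by rewrite addr_ge0 ?fine_ge0// divr_ge0// ltW.
  have [||d [d0 Ud dt]] := powR_perturb _ (fine (diam (U n))) a (tau n) _ a0.
  - by rewrite fine_ge0 ?diam_ge0.
  - by rewrite divr_gt0// ltr0n expn_gt0.
  apply: coverableS (small (U n) d [::] d0 _) => //.
    rewrite /len /= powR1 mulr1 ler_pM2l//; apply: le_trans dt _.
    by rewrite /f nD fine_poweR.
  move=> x y Ux Uy; apply: le_trans Ud.
  by rewrite -lee_fin fineK ?diam_fin//; apply: dist_le_diam.
under eq_eseriesr do rewrite EFinM EFinD fineK//.
rewrite nneseriesZl; last first.
  by move=> n _; rewrite adde_ge0// lee_fin divr_ge0// ltW.
have -> : t%:E = (C%:E * (t'%:E + t'%:E))%E.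
  by rewrite -EFinD -EFinM; congr EFin; rewrite /t'; field; rewrite gt_eqF.
apply: lee_wpmul2l; first by rewrite lee_fin ltW.
apply: le_trans (epsilon_trick xpredT f0 (ltW t'0)) _.
apply: leeD => //; rewrite nneseries_esumT// -esum_mkcond; exact: ltW.
Qed.

Theorem theorem1 (R : realType) (q : nat -> R) (q_stoch : stochastic q)
    (q_tail : forall a : R, 0 < a -> exists c : R, forall i : nat,
      (\sum_(i.+1 <= k <oo) (powR (q k) a)%:E <= (c * powR (q i) a)%:E)%E) :
  faithful (cylinders q) `[0, 1[%classic.
Proof.
move=> E E01; apply/eqP; rewrite eq_le; apply/andP; split.
  (* If [a] is admissible classically, every [a + e] is admissible for cylinders, and [e] tends to
     0. *)
  apply: le_ereal_inf_tmp => _ [a [a0 Ha] <-].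
  apply/lee_addgt0Pr => e e0; apply: ereal_inf_lbound.
  have ae0 : 0 < a + e by rewrite ltr_wpDl.
  exists (a + e) => //; split; first exact: ltW.
  apply/hausdorff_eq0 => eps eps0.
  apply: hausdorff_pre_eq0 => // t t0; exact: coverable_hausdorff0.
(* Conversely, coverings by cylinders are among the classical ones. *)
apply: ereal_inf_le_tmp => _ [a [a0 /hausdorff_eq0 Ha] <-].
exists a => //; split=> //; apply/hausdorff_eq0 => eps eps0.
apply/eqP; rewrite eq_le hausdorff_pre_ge0 andbT -(Ha eps eps0).
exact: hausdorff_pre_sub.
Qed.
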